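(* Let $M$ be a set system over a finite set $V$ and let $X \subseteq V$. Then $$M+X*X+X = M*X+X*X,$$ i.e. $((M+X)*X)+X = ((M*X)+X)*X$.
   Context: A set system over a finite set $V$ is a pair $M=(V,D)$ with $D$ a family of subsets of $V$. Operations are written postfix and associate to the left. $\oplus$ denotes symmetric difference of sets (and exclusive-or of truth values). Pivot: for $X\subseteq V$, $M*X=(V,\{Y\oplus X \mid Y\in D\})$. Loop complementation: for $j\in V$, $M+\{j\}=(V,D')$ where for all $Z\subseteq V$: if $j\in Z$, then $Z\in D'$ iff $(Z\in D)\oplus(Z\setminus\{j\}\in D)$; if $j\notin Z$, then $Z\in D'$ iff $Z\in D$. For $X=\{x_1,\dots,x_n\}\subseteq V$, $M+X$ denotes $M+\{x_1\}+\{x_2\}\cdots+\{x_n\}$ (the result does not depend on the order), with $M+\varnothing=M$. *)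

(* Defs.v *)
From mathcomp Require Import all_boot.

Set Implicit Arguments.
Unset Strict Implicit.
Unset Printing Implicit Defensive.

(* The finite ground set is the finType V itself, so a set system over V is
   determined by its family of subsets. *)
Definition set_system (V : finType) : Type := {set {set V}}.

Declare Scope setsys_scope.
Delimit Scope setsys_scope with SY.
Bind Scope setsys_scope with set_system.

Definition symdiff (V : finType) (Y X : {set V}) : {set V} :=
  (Y :\: X) :|: (X :\: Y).

Definition pivot (V : finType) (M : set_system V) (X : {set V}) :
    set_system V :=
  [set symdiff Y X | Y in M].

Definition loopc1 (V : finType) (M : set_system V) (j : V) : set_system V :=
  [set Z : {set V} |
    if j \in Z then (Z \in M) (+) (Z :\ j \in M) else Z \in M].

(* The elements of X are processed in the order of [enum X]; [loopc_order]
   below shows that every duplicate-free enumeration gives the same result. *)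
Definition loopc (V : finType) (M : set_system V) (X : {set V}) :
    set_system V :=
  foldl (@loopc1 V) M (enum X).

(* The usual precedences apply: * binds tighter than +. *)
Notation "M * X" := (pivot M X) : setsys_scope.
Notation "M + X" := (loopc M X) : setsys_scope.

Lemma in_loopc1 (V : finType) (M : set_system V) (j : V) (Z : {set V}) :
  (Z \in loopc1 M j) =
  if j \in Z then (Z \in M) (+) (Z :\ j \in M) else Z \in M.
Proof. by rewrite inE. Qed.

Lemma loopc1C (V : finType) (M : set_system V) (i j : V) :
  loopc1 (loopc1 M i) j = loopc1 (loopc1 M j) i.
Proof.
apply/setP=> Z; rewrite !in_loopc1.
have [-> //|nij] := eqVneq i j.
have E : Z :\ j :\ i = Z :\ i :\ j by rewrite !setDDl setUC.
rewrite !in_setD1 nij [j == i]eq_sym nij /= E.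
case: (i \in Z); case: (j \in Z) => //=.
by rewrite addbACA.
Qed.

Lemma loopc_order (V : finType) (M : set_system V) (X : {set V}) (s : seq V) :
  uniq s -> s =i X -> loopc M X = foldl (@loopc1 V) M s.
Proof.
move=> us sX; rewrite /loopc.
have : perm_eq (enum X) s.
  by apply: uniq_perm => //; [exact: enum_uniq | move=> x; rewrite mem_enum sX].
have pull (x : V) t (N : set_system V) :
    foldl (@loopc1 V) (loopc1 N x) t = loopc1 (foldl (@loopc1 V) N t) x.
  by elim: t N => //= y t IH N; rewrite loopc1C IH.
elim: (enum X) s M {us sX} => [|x t IH] s M.
  by rewrite perm_sym => /perm_nilP ->.
move=> pts; have xs : x \in s by rewrite -(perm_mem pts) mem_head.
case/splitPr: xs pts => s1 s2; rewrite perm_sym perm_catC /= perm_cons => p.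
rewrite (IH (s1 ++ s2)) ?foldl_cat /= ?pull //.
by rewrite perm_sym perm_catC.
Qed.

Lemma loopc0 (V : finType) (M : set_system V) : loopc M set0 = M.
Proof. by rewrite /loopc enum_set0. Qed.

Lemma loopc_set1 (V : finType) (M : set_system V) (j : V) :
  loopc M [set j] = loopc1 M j.
Proof. by rewrite /loopc enum_set1. Qed.

(* Main.v *)
(* Pivoting and loop complementation at distinct elements commute, so by
   induction on X the identity reduces to X a single element x. There, on the
   pair of truth values (Z \in M, x |: Z \in M) with x \notin Z, the pivot acts
   as the swap and loop complementation as (a, b) |-> (a, a (+) b): these are
   two distinct involutions of GL_2(F_2) = S_3, so they satisfy the braid
   relation. *)
Require Import Defs.
From mathcomp Require Import all_boot.

Section PivotLoopComplementation.

Variable V : finType.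
Implicit Types (M : set_system V) (X Y Z : {set V}) (x y : V).

Lemma in_symdiff Y X x : (x \in symdiff Y X) = (x \in Y) (+) (x \in X).
Proof. by rewrite !inE; case: (x \in Y); case: (x \in X). Qed.

Lemma symdiffK X : involutive (fun Y => symdiff Y X).
Proof. by move=> Y; apply/setP=> x; rewrite !in_symdiff addbK. Qed.

(** Symmetric difference with [X] is an involution, so the image defining the pivot is also a
    preimage. *)
Lemma in_pivot M X Z : (Z \in pivot M X) = (symdiff Z X \in M).
Proof.
rewrite -{1}[Z](symdiffK X).
exact: (mem_imset _ _ (inv_inj (symdiffK X))).
Qed.

Lemma pivot0 M : pivot M set0 = M.
Proof.
apply/setP=> Z; rewrite in_pivot; congr (_ \in M).
by apply/setP=> x; rewrite in_symdiff inE addbF.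
Qed.

Lemma pivot_symdiff M X Y : pivot (pivot M X) Y = pivot M (symdiff X Y).
Proof.
apply/setP=> Z; rewrite !in_pivot; congr (_ \in M).
by apply/setP=> x; rewrite !in_symdiff -addbA [(x \in X) (+) _]addbC.
Qed.

Lemma symdiff_set1 X x : x \notin X -> symdiff X [set x] = x |: X.
Proof.
move=> xX; apply/setP=> y; rewrite in_symdiff !inE.
by case: eqVneq => [->|_]; rewrite ?(negPf xX) ?addbF.
Qed.

Lemma symdiffC X Y : symdiff X Y = symdiff Y X.
Proof. by rewrite /symdiff setUC. Qed.

Lemma pivotU1 M x X :
  x \notin X -> pivot M (x |: X) = pivot (pivot M [set x]) X.
Proof. by move=> xX; rewrite pivot_symdiff symdiffC symdiff_set1. Qed.

Lemma pivotC M X Y : pivot (pivot M X) Y = pivot (pivot M Y) X.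
Proof. by rewrite !pivot_symdiff symdiffC. Qed.

(** As [x] is outside [X], symmetric difference with [X] preserves membership of [x] and commutes
    with removing [x]. *)
Lemma loopc1_pivot M x X :
  x \notin X -> loopc1 (pivot M X) x = pivot (loopc1 M x) X.
Proof.
move=> xX; apply/setP=> Z.
rewrite in_pivot !in_loopc1 !in_pivot in_symdiff (negPf xX) addbF.
case: ifP => // _; congr (_ (+) (_ \in M)).
apply/setP=> y; rewrite in_setD1 !in_symdiff in_setD1.
by case: eqVneq => [->|]; rewrite ?(negPf xX).
Qed.

Lemma loopc_loopc1 M x X : loopc (loopc1 M x) X = loopc1 (loopc M X) x.
Proof.
by rewrite /loopc; elim: (enum X) M => //= y s IH M; rewrite loopc1C IH.
Qed.

(** Order independence allows [x] to be processed first. *)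
Lemma loopcU1 M x X : x \notin X -> loopc M (x |: X) = loopc (loopc1 M x) X.
Proof.
move=> xX; rewrite (@loopc_order _ _ _ (x :: enum X)) //=.
  by rewrite mem_enum xX enum_uniq.
by move=> y; rewrite !inE mem_enum.
Qed.

Lemma loopc_pivot1 M x X :
  x \notin X -> loopc (pivot M [set x]) X = pivot (loopc M X) [set x].
Proof.
rewrite -mem_enum /loopc; elim: (enum X) M => //= y s IH M.
rewrite inE negb_or eq_sym => /andP[yx xs].
by rewrite loopc1_pivot ?inE // IH.
Qed.

Lemma loopc1_pivot1_braid M x :
  loopc1 (pivot (loopc1 M x) [set x]) x =
  pivot (loopc1 (pivot M [set x]) x) [set x].
Proof.
have inS Z : x \in Z -> symdiff Z [set x] = Z :\ x.
  move=> xZ; apply/setP=> y; rewrite in_symdiff !inE.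
  by case: eqVneq => [->|_]; rewrite ?xZ ?addbF.
apply/setP=> Z; rewrite !(in_loopc1, in_pivot) !in_symdiff !inE eqxx /=.
(* For [x] in [Z] both sides reduce to [Z \in M], otherwise to the exclusive-or of [Z \in M] and
   [x |: Z \in M]. *)
case xZ: (x \in Z) => /=.
  by rewrite inS // symdiff_set1 ?setD11 // setD1K // addbC addbK.
by rewrite symdiff_set1 ?xZ // inS ?setU11 // setU1K ?xZ // symdiff_set1 ?xZ // addbC.
Qed.

End PivotLoopComplementation.

Theorem theorem11 (V : finType) (M : set_system V) (X : {set V}) :
  (((M + X) * X) + X = ((M * X) + X) * X)%SY.
Proof.
have [n] := ubnP #|X|; elim: n => // n IH in M X *.
have [-> _|[x xX]] := set_0Vmem X; first by rewrite !(loopc0, pivot0).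
rewrite -(setD1K xX) cardsU1 setD11 add1n ltnS => ltYn.
have xY : x \notin X :\ x by rewrite setD11.
move: (X :\ x) => Y in xY ltYn *.
(* On the left, the operations at [x] are moved aside, so that the induction hypothesis applies to
   [Y] and [pivot (loopc1 M x) [set x]]. *)
rewrite !loopcU1 // !pivotU1 // -loopc_pivot1 // loopc_loopc1 IH //.
(* The outer [loopc1] at [x] moves inward to complete the braid word. *)
rewrite loopc1_pivot // -loopc_loopc1 loopc1_pivot // loopc1_pivot1_braid.
(* The pivot at [x] moves back out to its place on the right-hand side. *)
by rewrite (pivotC _ _ [set x] Y) loopc_pivot1 // -loopc1_pivot.
Qed.
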